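(* Let $q\ge3$ be an integer, let $\mathbb{T}_q=(V,E)$ be the $q$-regular tree endowed with counting measure and unit edge weights, let $1<p<\infty$, and let $\Omega\subset V$ be a nonempty finite subset. Set $$c_{p,q}=q\left(1-(q-1)^{-\frac{1}{p-1}}\right)^{p-1}.$$ Then $$\mathcal{R}_p(\Omega)\le\frac{1}{c_{p,q}}.$$
   Context: The $q$-regular tree $\mathbb{T}_q=(V,E)$ is the infinite connected graph without cycles in which every vertex has degree $q$; $x\sim y$ iff $\{x,y\}\in E$. It is endowed with $\mu(x)=1$ for all $x\in V$, and $\omega_{xy}=1$ if $x\sim y$, $\omega_{xy}=0$ otherwise. For a nonempty finite $\Omega\subset V$: $X_V(\Omega)=\{u:V\to\mathbb{R}:u=0\text{ in }V\setminus\Omega\}$; $E_p(u)=\frac12\sum_{x,y\in V}\omega_{xy}|u(y)-u(x)|^p$; for $x\in\Omega$, $\operatorname{Cap}_p(x,\Omega)=\inf\{E_p(\varphi):\varphi\in X_V(\Omega),\varphi(x)=1\}\in(0,\infty)$; and the capacitary radius is $\mathcal{R}_p(\Omega)=\max_{x\in\Omega}\operatorname{Cap}_p(x,\Omega)^{-1}$. *)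

(* Defs.v *)
From HB Require Import structures.
From mathcomp Require Import all_boot all_order all_algebra finmap.
From mathcomp Require Import all_classical all_reals all_analysis.

Set Implicit Arguments.
Unset Strict Implicit.
Unset Printing Implicit Defensive.

Import Order.TTheory GRing.Theory Num.Theory.

Local Open Scope classical_set_scope.
Local Open Scope ring_scope.
Local Open Scope fset_scope.

(* The field [regular_acyclic] speaks of repetition-free closed walks: one with
   two vertices is an edge traversed back and forth, so a cycle of the graph is
   such a walk with at least three vertices. *)
Record is_regular_tree (q : nat) (V : choiceType) (adj : rel V) : Prop := {
  regular_sym : symmetric adj;
  regular_irr : irreflexive adj;
  regular_infinite : infinite_set [set: V];
  regular_connected : forall x y : V, exists s : seq V,
    path adj x s /\ last x s = y;
  regular_acyclic : forall c : seq V, cycle adj c -> uniq c -> (size c <= 2)%N;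
  regular_degree : forall x : V, ([set y | adj x y] #= `I_q)%card
}.

Section Capacity.
Context {R : realType} {V : choiceType}.
Implicit Types (w : V -> V -> R) (p : R) (Omega : {fset V}) (x : V).

Definition unit_weight (adj : rel V) : V -> V -> R :=
  fun x y => if adj x y then 1 else 0.

Definition XV Omega : set (V -> R) :=
  [set u | forall y, y \notin Omega -> u y = 0].

(* Possibly infinite sum of nonnegative terms, hence extended-real valued. *)
Definition energy w p (u : V -> R) : \bar R :=
  ((2^-1)%:E *
   \esum_(xy in [set: V * V]) (w xy.1 xy.2 * `|u xy.2 - u xy.1| `^ p)%:E)%E.

Definition capacity w p x Omega : \bar R :=
  ereal_inf [set energy w p phi | phi in [set u | XV Omega u /\ u x = 1]].

(* In the extended reals [0^-1 = +oo], so a bound on this radius also bounds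
   the capacities away from 0.  The unit [-oo] of [maxe] is only the value at
   the empty set. *)
Definition capacitary_radius w p Omega : \bar R :=
  (\big[maxe/-oo]_(x <- Omega) (capacity w p x Omega)^-1)%E.

End Capacity.

Definition tree_constant {R : realType} (p : R) (q : nat) : R :=
  q%:R * (1 - (q%:R - 1) `^ (- (p - 1)^-1)) `^ (p - 1).

(* Main.v *)
Require Import Defs.
From HB Require Import structures.
From mathcomp Require Import all_boot all_order all_algebra finmap.
From mathcomp Require Import all_classical all_reals all_analysis.
From mathcomp Require Import ring lra.

Set Implicit Arguments.
Unset Strict Implicit.
Unset Printing Implicit Defensive.

Import Order.TTheory GRing.Theory Num.Theory.

Local Open Scope ring_scope.

(** Fix a vertex [x] and a function [u] of finite support with [u x = 1]; the
    claim is that the energy of [u] is at least [c = tree_constant p q].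

    Root the tree at [x] and let [d] be the distance to [x]; every edge then
    joins a vertex [y] to a child [z], with [d z = d y + 1].  On the whole tree
    the equilibrium potential is [r ^+ d y], where [r = decay p q]
    solves [(q - 1) * r `^ (p - 1) = 1]: for this value the [p]-flux
    [g (d y) `^ (p - 1)], where [g n = r ^+ n * (1 - r)] is the drop along an
    edge from depth [n] to depth [n + 1], splits evenly among the [q - 1]
    children, that is, the potential is [p]-harmonic off [x].

    The tangent inequality for the convex function [`|a| `^ p] at [a = t]
    ([powR_above_tangent]), used with [a = u y - u z] and [t = g (d y)] and
    summed over the edges of a large ball, bounds the energy of [u]
    ([energy_ge_children]) from below by
      [p * \sum t `^ (p - 1) * (u y - u z)
         - (p - 1) * \sum t `^ (p - 1) * t].
    The flux is a flow with source [x] only, so summation by parts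
    ([flow_identity]) turns the first sum into [c * u x = c].  Inside the ball
    [t] is itself the drop of the truncated potential [phi], and the same
    identity turns the second sum into [c * phi x], where [phi x <= 1].  Thus
    the energy is at least [p * c - (p - 1) * c = c].  Treating both sums by
    one identity avoids counting the vertices at each distance from [x].

    Acyclicity enters through [tree_branch]: two neighbors of [y] that are
    joined off [y] coincide.  It makes the parent of a vertex unique, which
    gives each vertex other than [x] exactly [q - 1] children. *)

(** * The tree rooted at a vertex *)

Section RootedTree.
Context {q : nat} {V : choiceType} {adj : rel V}.
Hypothesis htree : is_regular_tree q adj.

Let adjC y z : adj y z = adj z y.
Proof. exact: (regular_sym htree). Qed.

(** Otherwise a simple path from [a] to [b] off [y] would close up through [y]
    into a cycle with at least three vertices. *)
Lemma tree_branch (y a b : V) (s : seq V) :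
  adj y a -> adj y b -> path adj a s -> last a s = b -> y \notin a :: s ->
  a = b.
Proof.
move=> ya yb ps; case: (shortenP ps) => t pt ut sts lt yas.
have yat : y \notin a :: t.
  by apply: contra yas; rewrite !inE => /orP[->//|/sts ->]; rewrite orbT.
have cyc : cycle adj (y :: a :: t).
  by rewrite /= rcons_path ya pt lt adjC yb.
have := regular_acyclic htree cyc; rewrite cons_uniq yat ut => /(_ isT).
by case: t lt {pt ut sts yat cyc} => [|c t] // ->.
Qed.

(** These three properties characterize the graph distance to [x]: the last
    bounds [d] by it, and the second yields paths of length [d y] to [x]. *)
Definition depth_function (x : V) (d : V -> nat) : Prop :=
  [/\ d x = 0%N,
      forall y, y != x -> exists2 z, adj y z & d y = (d z).+1
    & forall y z, adj y z -> (d y <= (d z).+1)%N].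

Lemma exists_depth (x : V) : exists d, depth_function x d.
Proof.
pose P y n := `[< exists s, [/\ path adj y s, last y s = x & size s = n] >].
have exP y : exists n, P y n.
  have [s [ps ls]] := regular_connected htree y x.
  by exists (size s); apply/asboolP; exists s.
pose d y := ex_minn (exP y).
have dP y : exists s, [/\ path adj y s, last y s = x & size s = d y].
  by rewrite /d; case: ex_minnP => n /asboolP.
have d_min y s : path adj y s -> last y s = x -> (d y <= size s)%N.
  by move=> ps ls; rewrite /d; case: ex_minnP => n _; apply; apply/asboolP;
    exists s.
have d_lip y z : adj y z -> (d y <= (d z).+1)%N.
  move=> yz; have [s [ps ls <-]] := dP z.
  by apply: (d_min y (z :: s)); rewrite //= yz.
exists d; split=> // [|y yx].
  by apply/eqP; rewrite -leqn0; exact: (d_min x [::]).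
have [[|z s] [/= ps ls ds]] := dP y; first by rewrite ls eqxx in yx.
have /andP[yz pz] := ps; exists z => //.
by apply/eqP; rewrite eqn_leq d_lip//= -ds ltnS d_min.
Qed.

Section Depth.
Context {x : V} {d : V -> nat}.
Hypothesis hd : depth_function x d.

Lemma depth_eq0 y : d y = 0%N -> y = x.
Proof.
case: hd => _ dS _ dy; apply/eqP; apply: contraT => /dS[z _].
by rewrite dy.
Qed.

Lemma descend y : exists s,
  [/\ path adj y s, last y s = x & {in s, forall z, (d z < d y)%N}].
Proof.
have [n le_n] := ubnP (d y); elim: n y le_n => // n IHn y.
have [-> _|yx] := eqVneq y x; first by exists [::].
case: hd => _ /(_ y yx)[z yz ->] _; rewrite ltnS => /IHn[s [ps ls sz]].
exists (z :: s); split=> //=; first by rewrite yz.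
by move=> t; rewrite inE => /predU1P[->//|/sz]; exact: ltnW.
Qed.

(** Geodesics to [x] strictly decrease the depth, so those from [a] and [b]
    avoid [y], and [tree_branch] applies to their concatenation. *)
Lemma shallow_neighbor_unique y a b : adj y a -> adj y b ->
  (d a <= d y)%N -> (d b <= d y)%N -> a = b.
Proof.
move=> ya yb da db; have [s [ps ls sd]] := descend a.
have [t [pt lt td]] := descend b.
have y_far c r : adj y c -> (d c <= d y)%N ->
    {in r, forall z, (d z < d c)%N} -> y \notin c :: r.
  move=> yc dc rd; rewrite inE negb_or; apply/andP; split.
    by apply: contraTneq yc => <-; rewrite (regular_irr htree).
  by apply/negP => /rd; rewrite ltnNge dc.
apply: (@tree_branch y a b (s ++ rev (belast b t))) => //.
- rewrite cat_path ps ls -lt rev_path.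
  by under eq_path do rewrite adjC.
- rewrite last_cat ls; case: t lt {pt td} => [|c t] //= _.
  by rewrite rev_cons last_rcons.
- rewrite -cat_cons mem_cat negb_or y_far//= mem_rev.
  by apply: contra (y_far b t yb db td) => /mem_belast.
Qed.

Definition child y z := adj y z && (d z == (d y).+1).

(** An edge cannot join two vertices of equal depth: its far end would be a
    second neighbor of [y] no deeper than [y], beside the parent of [y]. *)
Lemma child_parent y z : adj y z -> child z y = ~~ child y z.
Proof.
case: (hd) => d0 dS dl yz; rewrite /child adjC yz /=.
have := dl _ _ yz; have := dl z y; rewrite adjC => /(_ yz) zy yz'.
have nyz : d y != d z.
  apply/eqP => e; have [yx|yx] := eqVneq y x.
    move: yz; rewrite (depth_eq0 (y := z)) -?e ?yx ?d0 //.
    by rewrite (regular_irr htree).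
  have [w yw dw] := dS _ yx.
  have wz : w = z.
    by apply: (shallow_neighbor_unique yw yz); rewrite ?dw// -dw e.
  by move: dw; rewrite wz e => /eqP; rewrite eqn_leq ltnn andbF.
move: nyz; rewrite neq_ltn => /orP[lt|lt].
  by rewrite (_ : d z = (d y).+1) ?eqxx ?[_ == _.+2]ltn_eqF//; apply/eqP;
    rewrite eqn_leq zy.
rewrite (_ : d y = (d z).+1) ?eqxx ?[_ == _.+2]ltn_eqF//.
by apply/eqP; rewrite eqn_leq yz'.
Qed.

Lemma exists_parent z : z != x -> exists p, forall y, child y z = (y == p).
Proof.
move=> zx; case: (hd) => _ /(_ z zx)[p zp dp] _; exists p => y.
apply/idP/eqP => [/andP[yz /eqP dz]|->]; last by rewrite /child adjC zp dp /=.
by apply: (@shallow_neighbor_unique z); rewrite // ?[adj z y]adjC ?dz // -dz dp.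
Qed.

Lemma no_parent y : child y x = false.
Proof. by case: hd => d0 _ _; rewrite /child d0 andbF. Qed.

Definition neighbors y : {fset V} := fset_set [set z | adj y z]%classic.

Lemma in_neighbors y z : (z \in neighbors y) = adj y z.
Proof.
rewrite in_fset_set; first by apply/idP/idP; rewrite inE.
by apply/finite_setP; exists q; exact: (regular_degree htree).
Qed.

Lemma count_children y (s : seq V) : uniq s ->
  (forall z, child y z -> z \in s) -> count (child y) s = (q - (y != x))%N.
Proof.
move=> us sub.
have -> : count (child y) s = count (child y) (neighbors y).
  rewrite -!size_filter; apply/perm_size/uniq_perm; rewrite ?filter_uniq//.
  move=> z; rewrite !mem_filter in_neighbors; case: (boolP (child y z)) => //=.
  by move=> yz; rewrite sub//; case/andP: yz => ->.
have /(congr1 (fun n => n - (y != x))%N) := count_predC (child y) (neighbors y).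
rewrite (card_fset_set (regular_degree htree y)) => <-.
suff -> : count (predC (child y)) (neighbors y) = (y != x) by rewrite addnK.
have -> : count (predC (child y)) (neighbors y)
        = count (child^~ y) (neighbors y).
  by apply: eq_in_count => z; rewrite in_neighbors => /child_parent ->.
have [->|yx] := eqVneq y x.
  by rewrite (eq_count (a2 := pred0)) ?count_pred0 // => z; exact: no_parent.
have [p hp] := exists_parent yx.
rewrite (eq_count hp) count_uniq_mem//.
have /andP[py _] : child p y by rewrite hp eqxx.
by rewrite in_neighbors adjC py.
Qed.

Lemma exists_ball N : exists B : {fset V}, forall y, (y \in B) = (d y <= N)%N.
Proof.
elim: N => [|N [B hB]].
  exists [fset x]%fset => y; rewrite inE leqn0; apply/eqP/eqP => [->|].
    by case: hd.
  exact: depth_eq0.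
exists (B `|` \bigcup_(y <- B) neighbors y)%fset => z.
rewrite inE hB; apply/orP/idP => [[/leqW//|/bigfcupP[y]]|].
  rewrite andbT hB in_neighbors adjC => dy zy; case: hd => _ _ /(_ _ _ zy).
  by move=> /leq_trans -> //.
rewrite leq_eqVlt ltnS => /predU1P[dz|]; last by left.
right; have zx : z != x by apply: contra_eq_neq dz => ->; case: hd => ->.
case: (hd) => _ /(_ z zx)[p zp dp] _; apply/bigfcupP; exists p.
  by rewrite andbT hB -ltnS -dp dz.
by rewrite in_neighbors adjC.
Qed.

(** * Summation by parts on a ball *)

Section Flow.
Context {R : realType} {N : nat} {B : {fset V}}.
Hypothesis hB : forall y, (y \in B) = (d y <= N)%N.

(** The hypothesis on [k] is Kirchhoff's law: what enters a vertex from its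
    parent leaves through its [q - 1] children.  So only the root contributes
    after the sum is rearranged by vertices; the law fails at the boundary of
    the ball, where [v] vanishes. *)
Lemma flow_identity (k : nat -> R) (v : V -> R) : (0 < q)%N ->
  (forall n, k n = (q%:R - 1) * k n.+1) ->
  (forall y, (N <= d y)%N -> v y = 0) ->
  \sum_(y <- B) \sum_(z <- B | child y z) k (d y) * (v y - v z)
    = q%:R * k 0%N * v x.
Proof.
move=> q0 kS v0.
transitivity (\sum_(y <- B) v y * (k (d y) * (count (child y) B)%:R
                  - \sum_(z <- B | child z y) k (d z))).
  under eq_bigr => y _ do rewrite (eq_bigr _ (fun z _ => mulrBr _ _ _)) sumrB.
  under [RHS]eq_bigr => y _ do rewrite mulrBr.
  rewrite !sumrB; congr (_ - _).
    apply: eq_bigr => y _; rewrite big_const_seq iter_addr_0.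
    by rewrite mulr_natr mulrnAr mulrC.
  rewrite (exchange_big_dep predT)//=; apply: eq_bigr => z _.
  by rewrite mulr_sumr; apply: eq_bigr => y _; rewrite mulrC.
have xB : x \in B by rewrite hB; case: hd => ->.
have cnt y : (d y < N)%N -> count (child y) B = (q - (y != x))%N.
  move=> dy; apply: count_children => // z /andP[_ /eqP dz].
  by rewrite hB dz.
(* At the root there is no inflow. *)
rewrite (bigD1_seq x)//= [X in v x * _ + X]big1_seq ?addr0 => [|y /andP[yx yB]].
  have [N0|N0] := leqP N (d x); first by rewrite v0// mul0r mulr0.
  rewrite cnt// eqxx subn0 big_pred0 => [|z]; last by rewrite no_parent.
  by case: hd => -> _ _; ring.
have [Ny|Ny] := leqP N (d y); first by rewrite v0// mul0r.
have [p hp] := exists_parent yx.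
have /andP[_ /eqP dy] : child p y by rewrite hp eqxx.
have pB : p \in B by rewrite hB (leq_trans _ (ltnW Ny))// dy leqnSn.
rewrite cnt// yx (eq_bigl _ _ hp) -big_filter filter_pred1_uniq// big_seq1.
by rewrite natrB// (kS (d p)) dy /=; ring.
Qed.

End Flow.

(** The factor [2^-1] of the energy cancels the double count of each edge as
    two ordered pairs, one of which goes from parent to child. *)
Lemma energy_ge_children {R : realType} {B : {fset V}} (p : R) (u : V -> R) :
  ((\sum_(y <- B) \sum_(z <- B | child y z) `|u y - u z| `^ p)%:E
    <= energy (unit_weight adj) p u)%E.
Proof.
set S := \sum_(y <- B) _.
have -> : S%:E = (2^-1%:E * (S + S)%:E)%E.
  by rewrite -EFinM; congr EFin; field.
apply: lee_wpmul2l; first by rewrite lee_fin invr_ge0.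
apply: esum_ge.
  exists [set` [fset yz in [seq (y, z) | y <- B, z <- B]]%fset]%classic.
  by split.
rewrite fsbig_finite//= set_fsetK sumEFin lee_fin.
rewrite (perm_big [seq (y, z) | y <- B, z <- B]) /=; last first.
  apply: uniq_perm; first exact: fset_uniq.
    by apply: allpairs_uniq; rewrite ?fset_uniq// => -[a b] [a' b'].
  by move=> yz; rewrite inE.
rewrite big_allpairs /= {2}/S (exchange_big_dep predT)//= -big_split /=.
apply: ler_sum => y _; rewrite big_mkcond [X in _ + X <= _]big_mkcond.
rewrite -big_split /=; apply: ler_sum => z _; rewrite /unit_weight distrC.
have [yz|nyz] := boolP (adj y z).
  rewrite mul1r (child_parent yz) distrC; case: (child y z) => /=.
    by rewrite addr0.
  by rewrite add0r.
by rewrite /child [adj z y]adjC (negPf nyz) /= mul0r addr0.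
Qed.

End Depth.
End RootedTree.

(** * The equilibrium potential *)

(** Young's inequality for [`|a|] and [t `^ (p - 1)], whose exponents [p] and
    [p / (p - 1)] are conjugate. *)
Lemma powR_above_tangent {R : realType} (p a t : R) : 1 < p -> 0 <= t ->
  p * t `^ (p - 1) * a - (p - 1) * t `^ p <= `|a| `^ p.
Proof.
move=> p1 t0; have p0 : 0 < p by lra.
have p10 : 0 < p - 1 by lra.
have := @conjugate_powR R `|a| (t `^ (p - 1)) p (p / (p - 1)) (normr_ge0 _)
  (powR_ge0 _ _) p0 (divr_gt0 p0 p10).
rewrite -powRrM (_ : (p - 1) * (p / (p - 1)) = p); last by field; rewrite gt_eqF.
have conj : p^-1 + (p / (p - 1))^-1 = 1 by field; rewrite !gt_eqF.
move=> /(_ conj){conj}.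
have -> : `|a| `^ p / p + t `^ p / (p / (p - 1))
        = (`|a| `^ p + (p - 1) * t `^ p) / p by field; rewrite !gt_eqF.
rewrite ler_pdivlMr// => young; rewrite lerBlDr; apply: le_trans young.
rewrite -mulrA [_ * p]mulrC ler_pM2l// mulrC.
by apply: ler_wpM2r; [exact: powR_ge0|exact: ler_norm].
Qed.

Section Decay.
Context {R : realType} (p : R) (q : nat).
Hypotheses (hp : 1 < p) (hq : (3 <= q)%N).

Definition decay : R := (q%:R - 1) `^ (- (p - 1)^-1).

Lemma branching_gt1 : 1 < q%:R - 1 :> R.
Proof. have : 3%:R <= q%:R :> R by rewrite ler_nat. lra. Qed.

Lemma decay_gt0 : 0 < decay.
Proof. by apply: powR_gt0; have := branching_gt1; lra. Qed.

Lemma decay_lt1 : decay < 1.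
Proof.
have b := branching_gt1.
rewrite /decay powRN invf_lt1; last by rewrite powR_gt0; lra.
rewrite [ltLHS](_ : 1 = 1 `^ (p - 1)^-1); last by rewrite powR1.
by apply: gt0_ltr_powR; rewrite ?invr_gt0 ?subr_gt0 ?nnegrE//; lra.
Qed.

Lemma decay_powR : decay `^ (p - 1) = (q%:R - 1)^-1.
Proof.
have b := branching_gt1.
by rewrite -powRrM mulNr mulVf ?powR_inv1 ?gt_eqF ?subr_gt0//; lra.
Qed.

Definition gradient n : R := decay ^+ n * (1 - decay).

Lemma gradient_ge0 n : 0 <= gradient n.
Proof.
have := decay_lt1; have := decay_gt0 => ? ?.
by rewrite mulr_ge0 ?exprn_ge0; lra.
Qed.

(** Kirchhoff's law for the flux of the equilibrium potential, which is what
    the exponent in [decay] is chosen for. *)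
Lemma gradient_flow n :
  gradient n `^ (p - 1) = (q%:R - 1) * gradient n.+1 `^ (p - 1).
Proof.
have b := branching_gt1; have r0 := decay_gt0.
have -> : gradient n.+1 = decay * gradient n by rewrite /gradient exprS mulrA.
rewrite powRM ?gradient_ge0 ?(ltW r0)// decay_powR mulrA divff ?mul1r//; lra.
Qed.

Lemma gradient0_powR : q%:R * gradient 0 `^ (p - 1) = tree_constant p q.
Proof. by rewrite /gradient expr0 mul1r. Qed.

Lemma tree_constant_gt0 : 0 < tree_constant p q :> R.
Proof.
have b := branching_gt1; have := decay_lt1 => r1.
by rewrite mulr_gt0 ?powR_gt0; rewrite -/decay; lra.
Qed.

End Decay.

(** * The lower bound on the energy *)

Lemma energy_ge_tree_constant (R : realType) (q : nat) (V : choiceType)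
    (adj : rel V) (p : R) (Omega : {fset V}) (x : V) (u : V -> R) :
  (3 <= q)%N -> is_regular_tree q adj -> 1 < p -> XV Omega u -> u x = 1 ->
  ((tree_constant p q)%:E <= energy (unit_weight adj) p u)%E.
Proof.
move=> hq htree hp uO ux; have [d hd] := exists_depth htree x.
(* Every vertex of [Omega] is strictly less deep than [N], since
   [flow_identity] needs [u] to vanish on the sphere of radius [N]. *)
pose N := (\max_(y <- Omega) d y).+1.
have u0 y : (N <= d y)%N -> u y = 0.
  move=> Ny; apply: uO; apply: contraTN Ny => yO.
  by rewrite -ltnNge ltnS leq_bigmax_seq.
have [B hB] := exists_ball htree hd N.
pose g : nat -> R := gradient p q.
(* The equilibrium potential, lowered and cut off so as to vanish from
   depth [N] on. *)
pose phi y : R := decay p q ^+ minn (d y) N - decay p q ^+ N.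
have phi0 y : (N <= d y)%N -> phi y = 0.
  by move=> Ny; rewrite /phi (minn_idPr Ny) subrr.
have flow v := flow_identity htree hd hB (v := v) (ltnW (ltnW hq))
  (gradient_flow hp hq).
apply: le_trans _ (energy_ge_children htree hd p u (B := B)).
rewrite lee_fin.
apply: (@le_trans _ _ (\sum_(y <- B) \sum_(z <- B | child (adj:=adj) (d:=d) y z)
  (p * (g (d y) `^ (p - 1) * (u y - u z))
   - (p - 1) * (g (d y) `^ (p - 1) * (phi y - phi z))))); last first.
  rewrite big_seq [leRHS]big_seq; apply: ler_sum => y yB.
  rewrite big_seq_cond [leRHS]big_seq_cond; apply: ler_sum => z.
  move=> /andP[zB /andP[_ /eqP dz]].
  have yN : (d y < N)%N by move: zB; rewrite hB dz.
  have -> : phi y - phi z = g (d y).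
    rewrite /phi dz (minn_idPl (ltnW yN)) (minn_idPl yN) /g /gradient exprS.
    by ring.
  have gpow : g (d y) `^ p = g (d y) `^ (p - 1) * g (d y).
    rewrite -[X in _ * X]powRr1 ?gradient_ge0// -powRD ?subrK//.
    by apply/implyP; rewrite gt_eqF//; lra.
  by rewrite mulrA -gpow powR_above_tangent// gradient_ge0.
under eq_bigr => y _ do
  rewrite sumrB -[X in X - _]mulr_sumr -[X in _ - X]mulr_sumr.
rewrite sumrB -[X in X - _]mulr_sumr -[X in _ - X]mulr_sumr
  !flow// gradient0_powR ux.
have phix : phi x <= 1.
  case: hd => d0 _ _; rewrite /phi d0 min0n expr0 lerBlDr lerDl.
  by rewrite exprn_ge0// ltW// decay_gt0.
have c0 := tree_constant_gt0 hp hq.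
have := mulr_ge0 (ltW c0) (_ : 0 <= 1 - phi x).
nra.
Qed.

Local Open Scope fset_scope.

Theorem proposition3p16 (R : realType) (q : nat) (V : choiceType)
    (adj : rel V) (p : R) (Omega : {fset V})
    (hq : (3 <= q)%N) (htree : is_regular_tree q adj)
    (hp : 1 < p) (hOmega : Omega != fset0) :
  (capacitary_radius (unit_weight adj) p Omega <= (1 / tree_constant p q)%:E)%E.
Proof.
apply: bigmax_le => [|x _]; first exact: leNye.
have c0 := tree_constant_gt0 hp hq.
have cap : ((tree_constant p q)%:E <= capacity (unit_weight adj) p x Omega)%E.
  apply: le_ereal_inf_tmp => _ [u [uO ux] <-].
  exact: energy_ge_tree_constant uO ux.
have c0E : (0 <= (tree_constant p q)%:E :> \bar R)%E by rewrite lee_fin ltW.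
have -> : (1 / tree_constant p q)%:E = ((tree_constant p q)%:E^-1)%E :> \bar R.
  by rewrite inver gt_eqF// div1r.
by rewrite lee_pV2// inE//; exact: le_trans cap.
Qed.
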